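(* Let $q$ be a power of an odd prime. The (unique, semisimple) conjugacy class of involutions of $\mathrm{PSL}(2,q)$, considered as a rack, is (1) abelian if $q=3$, and (2) neither abelian nor minimal non-abelian if $q>3$.
   Context: A rack is a non-empty set $X$ with a binary operation $\triangleright$ such that every map $y\mapsto x\triangleright y$ is bijective and $x\triangleright(y\triangleright z)=(x\triangleright y)\triangleright(x\triangleright z)$. Conjugacy classes of a group are racks via $g\triangleright h=ghg^{-1}$. A subrack is a non-empty subset closed under $\triangleright$. A rack is abelian if $x\triangleright y=y$ for all $x,y$; it is minimal non-abelian if it is not abelian but all of its proper subracks are abelian. For $q$ odd, $\mathrm{PSL}(2,q)$ has exactly one conjugacy class of involutions. *)

(* Defs.v *)
From HB Require Import structures.
From mathcomp Require Import all_boot all_order all_algebra all_fingroup.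
From mathcomp Require Import all_solvable all_field.

Set Implicit Arguments.
Unset Strict Implicit.
Unset Printing Implicit Defensive.

Import GRing.Theory GroupScope.

Record rack := Rack {
  rack_sort :> Type;
  rack_op : rack_sort -> rack_sort -> rack_sort;
  rack_nonempty : inhabited rack_sort;
  rack_bij : forall x, bijective (rack_op x);
  rack_dist : forall x y z,
    rack_op x (rack_op y z) = rack_op (rack_op x y) (rack_op x z) }.

Definition subrack (X : rack) (S : X -> Prop) : Prop :=
  (exists x, S x) /\ (forall x y, S x -> S y -> S (rack_op x y)).

Definition proper_subrack (X : rack) (S : X -> Prop) : Prop :=
  subrack S /\ exists x, ~ S x.

Definition rack_abelian_on (X : rack) (S : X -> Prop) : Prop :=
  forall x y, S x -> S y -> rack_op x y = y.

Definition rack_abelian (X : rack) : Prop :=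
  rack_abelian_on (fun _ : X => True).

Definition rack_minimal_nonabelian (X : rack) : Prop :=
  ~ rack_abelian X /\
  forall S : X -> Prop, proper_subrack S -> rack_abelian_on S.

Section ClassRack.

Variables (gT : finGroupType) (G : {group gT}) (C : {set gT}).
Hypothesis CG : C \in classes G.

Definition class_sort : Type := {x : gT | x \in C}.

Lemma class_conj (x y : gT) : x \in C -> y \in C -> (y ^ x \in C) * (y ^ x^-1 \in C).
Proof.
case/imsetP: CG => t tG -> xt yt.
have xG : x \in G by apply: (subsetP (class_subG tG (subxx G))).
by rewrite -(class_eqP yt) !memJ_class ?groupV.
Qed.

Lemma class_conjC (x y : gT) : x \in C -> y \in C -> x * y * x^-1 \in C.
Proof.
by move=> xC yC; have := (class_conj xC yC).2; rewrite conjgE invgK mulgA.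
Qed.

Lemma class_conjVC (x y : gT) : x \in C -> y \in C -> x^-1 * y * x \in C.
Proof. by move=> xC yC; have := (class_conj xC yC).1; rewrite conjgE mulgA. Qed.

Definition class_op (x y : class_sort) : class_sort :=
  exist _ (val x * val y * (val x)^-1) (class_conjC (valP x) (valP y)).

Lemma class_inhabited : inhabited class_sort.
Proof.
by have [t tG defC] := imsetP CG; split; exists t; rewrite defC class_refl.
Qed.

Lemma class_op_bij x : bijective (class_op x).
Proof.
exists (fun y => exist _ ((val x)^-1 * val y * val x)
                       (class_conjVC (valP x) (valP y))) => y;
  by apply: val_inj; rewrite /= ?mulgA ?mulVg ?mulgV ?mul1g ?mulgKV ?mulgK.
Qed.

Lemma class_op_dist x y z :
  class_op x (class_op y z) = class_op (class_op x y) (class_op x z).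
Proof. by apply: val_inj; rewrite /= !invMg !invgK !mulgA !mulgKV. Qed.

Definition class_rack : rack :=
  Rack class_inhabited class_op_bij class_op_dist.

End ClassRack.

Section PSL2.

Variable F : finFieldType.

Definition SL2 : {set {'GL_2[F]}} := [set u | (\det (GLval u) == 1)%R].

Lemma SL2_group_set : group_set SL2.
Proof.
apply/group_setP; split=> [|u v]; rewrite !inE ?GL_1E ?det1 // => /eqP du /eqP dv.
by rewrite GL_ME det_mulmx du dv mulr1.
Qed.
Canonical SL2_group := Group SL2_group_set.

Definition PSL2 := SL2 / 'Z(SL2).
Canonical PSL2_group := [group of PSL2].

(* A matrix is semisimple when it becomes diagonalizable over some extension
   field; an element of PSL(2,F) is semisimple when it is the image of a
   semisimple element of SL(2,F). *)
Definition semisimple_mx (n : nat) (A : 'M[F]_n) : Prop :=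
  exists L : fieldExtType F, diagonalizable (map_mx (in_alg L) A).

Definition semisimple (x : coset_of 'Z(SL2)) : Prop :=
  exists2 u : {'GL_2[F]}, u \in SL2 &
    coset 'Z(SL2) u = x /\ semisimple_mx (GLval u).

End PSL2.

Definition involution_class (gT : finGroupType) (G : {group gT})
    (C : {set gT}) : Prop :=
  C \in classes G /\ forall x, x \in C -> #[x] = 2.

(* Main.v *)
Require Import Defs.
From mathcomp Require Import all_boot all_order all_algebra all_fingroup.
From mathcomp Require Import all_solvable all_field.
From mathcomp Require Import ring.

Set Implicit Arguments.
Unset Strict Implicit.
Unset Printing Implicit Defensive.

Import GRing.Theory.

(** Elements of [PSL(2,F)] are handled as matrices of determinant one up to
    sign: [psl A] is the class of [A], two classes agree exactly when the
    matrices agree up to sign ([psl_eq]), and the equation of racks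
    [psl A |> psl B = psl D] means [A * B = D * A] up to sign ([psl_conj]).

    By Cayley-Hamilton, [psl A] has order two exactly when the trace of [A]
    vanishes ([order_psl]), that is, when [A ^+ 2 = -1].  All these matrices are
    conjugate in [SL(2,F)] to [0 1; -1 0]: if a row vector [v] satisfies
    [det (v; v A) = 1], the matrix with rows [v] and [v A] is a conjugator.
    Such a [v] exists because [v |-> det (v; v A)] is a nondegenerate binary
    quadratic form, which represents one over a finite field
    ([traceless_conj]).  So there is a single class of involutions.  It is
    semisimple, since ['X^2 + 1] has distinct roots in a splitting field.

    For [q = 3] there are only three involutions, and the matrices representing
    them commute or anticommute pairwise.

    For [q > 3] a proper non-abelian subrack refutes both properties at once.
    If [i ^+ 2 = -1] for some [i] in [F], the involutions [i b; 0 -i] of the Borel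
    subgroup form one ([borel_subrack]).  If [-1] is not a square, the
    involutions [0 t; -t^-1 0], which normalize the split torus, do
    ([monomial_subrack]): those for [1] and [r] commute only if [r ^+ 4 = 1],
    which now means that [r] is [1] or [-1], and [F] has another nonzero
    element. *)

(** * Two by two matrices *)

Section LinearCombination.

Local Open Scope ring_scope.

(** Membership of [x - y] in the ideal generated by the hypotheses, one
    generator per use; the remaining goal is an identity left to [ring]. *)
Lemma lincomb (R : pzRingType) (k u v x y : R) :
  u = v -> x - y = k * (u - v) -> x = y.
Proof. by move=> ->; rewrite subrr mulr0 => /eqP; rewrite subr_eq0 => /eqP. Qed.

End LinearCombination.

Arguments lincomb {R} k {u v x y}.

Section Matrix2.

Local Open Scope ring_scope.

Variable R : comNzRingType.

Definition mx2 (a b c d : R) : 'M[R]_2 :=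
  \matrix_(i, j) if i == 0 then (if j == 0 then a else b)
                 else (if j == 0 then c else d).

Lemma mx2P (A B : 'M[R]_2) :
  A 0 0 = B 0 0 -> A 0 1 = B 0 1 -> A 1 0 = B 1 0 -> A 1 1 = B 1 1 -> A = B.
Proof.
have ord2 (i : 'I_2) : i = 0 \/ i = 1.
  by case: i => [[|[|n]]] // lt_i2; [left | right]; apply: val_inj.
move=> ? ? ? ?; apply/matrixP=> i j.
by case: (ord2 i) => ->; case: (ord2 j) => ->.
Qed.

Lemma mx2_eta (A : 'M[R]_2) : A = mx2 (A 0 0) (A 0 1) (A 1 0) (A 1 1).
Proof. by apply: mx2P; rewrite !mxE. Qed.

Lemma eq_mx2 a b c d a' b' c' d' : mx2 a b c d = mx2 a' b' c' d' ->
  [/\ a = a', b = b', c = c' & d = d'].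
Proof.
move=> /matrixP eqA.
by have := (eqA 0 0, eqA 0 1, eqA 1 0, eqA 1 1);
  rewrite !mxE /= => -[[[-> ->] ->] ->].
Qed.

Lemma mulmx2 a b c d a' b' c' d' :
  mx2 a b c d * mx2 a' b' c' d' =
  mx2 (a * a' + b * c') (a * b' + b * d') (c * a' + d * c') (c * b' + d * d').
Proof. by apply: mx2P; rewrite mxE !big_ord_recl big_ord0 !mxE /= addr0. Qed.

Lemma oppmx2 a b c d : - mx2 a b c d = mx2 (- a) (- b) (- c) (- d).
Proof. by apply: mx2P; rewrite !mxE. Qed.

Lemma scalar_mx2 a : a%:M = mx2 a 0 0 a.
Proof. by apply: mx2P; rewrite !mxE. Qed.

Lemma det_mx2 a b c d : \det (mx2 a b c d) = a * d - b * c.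
Proof.
rewrite (expand_det_row _ 0) !big_ord_recl big_ord0 /cofactor !det_mx11 !mxE /=.
by rewrite expr0 expr1 mul1r addr0 mulN1r mulrN.
Qed.

Lemma tr_mx2 a b c d : \tr (mx2 a b c d) = a + d.
Proof. by rewrite /mxtrace !big_ord_recl big_ord0 !mxE /= addr0. Qed.

(** The Cayley-Hamilton theorem in dimension two. *)
Lemma mx2_sqr (A : 'M[R]_2) : A * A = (\tr A) *: A - (\det A)%:M.
Proof.
rewrite [A]mx2_eta; move: (A 0 0) (A 0 1) (A 1 0) (A 1 1) => a b c d.
rewrite mulmx2 tr_mx2 det_mx2; apply: mx2P; rewrite !mxE /= ?mulr1n ?mulr0n; ring.
Qed.

Lemma traceless_mx2 (A : 'M[R]_2) : \det A = 1 -> \tr A = 0 ->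
  exists a b c, a ^+ 2 + b * c = - 1 /\ A = mx2 a b c (- a).
Proof.
rewrite [A]mx2_eta; move: (A 0 0) (A 0 1) (A 1 0) (A 1 1) => a b c d.
rewrite det_mx2 tr_mx2 => det1 tr0; have da : d = - a by apply: (lincomb 1 tr0); ring.
exists a, b, c; rewrite da; split=> //; apply: (lincomb (- 1) det1); rewrite da; ring.
Qed.

End Matrix2.

(** * Sums of two squares *)

Section Squares.

Local Open Scope ring_scope.

Variable F : finFieldType.

(** More than half of the elements of [F] are squares, so the squares and the
    elements [c - y ^+ 2] cannot be disjoint. *)
Lemma sum_two_squares (c : F) : exists x y : F, x ^+ 2 + y ^+ 2 = c.
Proof.
pose A : {set F} := [set x ^+ 2 | x in F].
pose B : {set F} := [set c - x | x in A].
have lt_FA : (#|F| < 2 * #|A|)%N.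
  (* [x] is recovered from its square and the choice of one of the two roots;
     the pair [(0, false)] is not reached, which makes the bound strict. *)
  pose f (x : F) := (x ^+ 2, x == odflt 0 [pick y | y ^+ 2 == x ^+ 2]).
  have fI : injective f.
    move=> x y [exy]; rewrite exy; case: pickP => [r /eqP r2|/(_ y)];
      last by rewrite eqxx.
    move: exy => /=; have := r2; move/eqP; rewrite eqf_sqr => /orP er /eqP.
    rewrite eqf_sqr => /orP exy.
    case: eqP => [->|nxr]; first by move/esym/eqP.
    move/esym/eqP => nyr; case: exy => /eqP // exy; case: er => /eqP er.
      by case: nyr.
    by case: nxr; rewrite exy er.
  have sub : [set f x | x in F] \proper setX A [set: bool].
    apply/properP; split.
      by apply/subsetP=> _ /imsetP[x _ ->]; rewrite !inE /f /= andbT; apply: imset_f.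
    exists (0, false).
      by rewrite !inE andbT; apply/imsetP; exists 0; rewrite ?expr0n.
    apply/negP=> /imsetP[x _ [/esym/eqP]]; rewrite sqrf_eq0 => /eqP->.
    case: pickP => [r /=|/(_ 0)]; last by rewrite eqxx.
    by rewrite expr0n sqrf_eq0 => /eqP->; rewrite eqxx.
  have := proper_card sub; rewrite card_imset // cardsX cardsT card_bool.
  by rewrite mulnC => /leq_trans-> //.
have cardB : #|B| = #|A| by apply: card_imset => x y /addrI/oppr_inj.
have : A :&: B != set0.
  apply: contraTneq lt_FA => AB0; rewrite -leqNgt mul2n -addnn -{2}cardB.
  by rewrite -cardsUI AB0 cards0 addn0 max_card.
case/set0Pn=> z /setIP[/imsetP[x _ zx] /imsetP[t /imsetP[y _ ->] zy]].
by exists x, y; rewrite -zx zy subrK.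
Qed.

End Squares.

(** * The projective special linear group *)

Section PSL.

Variable F : finFieldType.
Local Notation Z := 'Z(SL2 F)%g.

Definition gl_of (A : 'M[F]_2) : {'GL_2[F]} := insubd (1%g : {'GL_2[F]}) A.

Definition psl (A : 'M[F]_2) : coset_of Z := coset Z (gl_of A).

Local Open Scope ring_scope.

Implicit Types A B D : 'M[F]_2.

Lemma gl_ofK A : \det A = 1 -> GLval (gl_of A) = A.
Proof.
move=> detA; apply: insubdK; have : A \in unitmx by rewrite unitmxE detA unitr1.
exact: id.
Qed.

Lemma GLvalK (u : {'GL_2[F]}) : gl_of (GLval u) = u.
Proof. exact: valKd. Qed.

Lemma GLval_inj : injective (@GLval 2 F).
Proof. exact: val_inj. Qed.

Lemma gl_of_SL2 A : \det A = 1 -> gl_of A \in SL2 F.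
Proof. by move=> detA; rewrite inE gl_ofK ?detA. Qed.

Lemma gl_of_norm A : \det A = 1 -> gl_of A \in 'N(Z)%g.
Proof.
move=> detA; apply: (subsetP (normal_norm (center_normal _))).
exact: gl_of_SL2.
Qed.

Lemma gl_ofM A B : \det A = 1 -> \det B = 1 -> gl_of (A * B) = (gl_of A * gl_of B)%g.
Proof.
move=> detA detB; apply: GLval_inj.
by rewrite GL_ME !gl_ofK ?det_mulmx ?detA ?detB ?mulr1.
Qed.

Lemma pslM A B : \det A = 1 -> \det B = 1 -> psl (A * B) = (psl A * psl B)%g.
Proof. by move=> detA detB; rewrite /psl gl_ofM // morphM ?gl_of_norm. Qed.

Lemma psl_mem A : \det A = 1 -> psl A \in PSL2 F.
Proof. by move=> /gl_of_SL2 ?; apply: mem_quotient. Qed.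

Lemma psl_surj x : x \in PSL2 F -> exists2 A, \det A = 1 & x = psl A.
Proof.
case/morphimP=> u _; rewrite inE => /eqP detu ->.
by exists (GLval u); rewrite // /psl GLvalK.
Qed.

(** Commuting with the matrices [0 1; -1 0] and [1 1; 0 1] already forces a
    matrix to be scalar. *)
Lemma mem_centerSL2 A : \det A = 1 -> (gl_of A \in Z) = (A == 1) || (A == - 1).
Proof.
move=> detA; apply/idP/orP=> [/centerP[_ cA] | Apm1].
  have comm B : \det B = 1 -> A * B = B * A.
    move=> detB; have /(congr1 (fun u => GLval u)) := cA _ (gl_of_SL2 detB).
    by rewrite !GL_ME !gl_ofK.
  have := comm (mx2 0 1 (- 1) 0); have := comm (mx2 1 1 0 1).
  move: detA; rewrite [A]mx2_eta.
  move: (A 0 0) (A 0 1) (A 1 0) (A 1 1) => a b c d; rewrite !det_mx2 !mulmx2.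
  move=> det1 /(_ _)/eq_mx2[]; first by ring.
  move=> e1 e2 _ _ /(_ _)/eq_mx2[]; first by ring.
  move=> e3 e4 _ _.
  have c0 : c = 0 by apply: (lincomb (- 1) e1); ring.
  have b0 : b = 0 by apply: (lincomb (- 1) e3); rewrite c0; ring.
  have da : d = a by apply: (lincomb (- 1) e2); ring.
  have /eqP : a ^+ 2 = 1 by apply: (lincomb 1 det1); rewrite c0 da; ring.
  rewrite sqrf_eq1 b0 c0 da -scalar_mx2 => /orP[]/eqP->; [by left | right].
  by rewrite -scalemx1 scaleN1r.
apply/centerP; split=> [|u uSL]; first exact: gl_of_SL2.
by apply: GLval_inj; rewrite !GL_ME gl_ofK //;
  case: Apm1 => /eqP->; rewrite ?mul1r ?mulr1 ?mulN1r ?mulrN1.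
Qed.

Lemma psl_eq A B : \det A = 1 -> \det B = 1 -> psl A = psl B <-> A = B \/ A = - B.
Proof.
move=> detA detB; split=> [/kercoset_rcoset | ].
  case; rewrite ?gl_of_norm // => z zZ eA.
  have detz : \det (GLval z) = 1.
    by have := subsetP (center_sub _) _ zZ; rewrite inE => /eqP.
  have -> : A = GLval z * B by rewrite -[A]gl_ofK // eA GL_ME gl_ofK.
  move: zZ; rewrite -(GLvalK z) mem_centerSL2 // GLvalK => /orP[]/eqP->.
    by left; rewrite mul1r.
  by right; rewrite mulN1r.
case=> [-> // | eA].
have det1 : \det (- 1 : 'M[F]_2) = 1.
  by rewrite -scaleN1r detZ sqrrN expr1n det1 mulr1.
apply/rcoset_kercosetP; rewrite ?gl_of_norm //; apply/rcosetP.
exists (gl_of (- 1)); first by rewrite mem_centerSL2 ?eqxx ?orbT.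
by rewrite -gl_ofM // mulN1r eA.
Qed.

Lemma psl_conj A B D : \det A = 1 -> \det B = 1 -> \det D = 1 ->
  (psl A * psl B * (psl A)^-1 = psl D)%g <-> A * B = D * A \/ A * B = - (D * A).
Proof.
move=> detA detB detD.
rewrite -psl_eq ?det_mulmx ?detA ?detB ?detD ?mulr1 // !pslM //.
by split=> [<- | ->]; rewrite ?mulgK ?mulgKV.
Qed.

Hypothesis odd_F : 2%:R != 0 :> F.

(** Cayley-Hamilton reads [A * A = \tr A *: A - 1].  If the trace vanishes, the
    square is [-1].  If it does not, a square equal to [1] or [-1] makes [A]
    scalar, so that [psl A] is trivial. *)
Lemma order_psl A : \det A = 1 -> (#[psl A]%g == 2) = (\tr A == 0).
Proof.
move=> detA; have := mx2_sqr A; rewrite detA => sqA.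
have psl1 : psl 1 = 1%g.
  by apply: (mulgI (psl 1)); rewrite -pslM ?det1 // mulr1 mulg1.
have psl1P B : \det B = 1 -> psl B = 1%g <-> B = 1 \/ B = - 1.
  by move=> detB; rewrite -psl1; apply: psl_eq; rewrite ?det1.
have psl2 : (psl A ^+ 2)%g = psl (A * A) by rewrite expgS expg1 pslM.
have detAA : \det (A * A) = 1 by rewrite det_mulmx detA mulr1.
have [tr0 | tr_n0] := eqVneq (\tr A) 0.
  apply/eqP/nt_prime_order => //.
    by rewrite psl2 psl1P // sqA tr0 scale0r sub0r; right.
  apply/eqP; rewrite psl1P // => A_pm1.
  have : \tr A != 0; last by rewrite tr0 eqxx.
  by case: A_pm1 => ->; rewrite ?raddfN /= mxtrace1 ?oppr_eq0.
apply/negP=> /eqP ordA; have := expg_order (psl A); rewrite ordA psl2 psl1P //.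
have /eqP nA : psl A != 1%g by rewrite -order_eq1 ordA.
have A_scal c : (\tr A) *: A = c%:M -> A = ((\tr A)^-1 * c)%:M.
  by move=> e; rewrite -scale_scalar_mx -e scalerA mulVf // scale1r.
case=> sq; move: sqA; rewrite sq => /esym/eqP; rewrite subr_eq => /eqP e.
  have {}e : (\tr A) *: A = (1 + 1)%:M by rewrite e [RHS]raddfD.
  have [c defA] : exists c, A = c%:M by eexists; apply: A_scal e.
  move: detA; rewrite defA det_scalar => /eqP; rewrite sqrf_eq1 => c1.
  case: nA; rewrite psl1P defA.
    by case/orP: c1 => /eqP->; [left | right; rewrite -scalemx1 scaleN1r].
  by rewrite det_scalar; apply/eqP; rewrite sqrf_eq1.
have := A_scal 0; rewrite e addNr raddf0 => /(_ erefl); rewrite mulr0 raddf0 => A0.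
by move: detA; rewrite A0 det0 => /esym/eqP; rewrite oner_eq0.
Qed.

End PSL.

(** * The field with three elements *)

Section ThreeElements.

Variable F : finFieldType.
Hypothesis F3 : #|F| = 3.

Local Open Scope ring_scope.

Lemma three_eq0 : 3%:R = 0 :> F.
Proof.
have : 3 \in [pchar F] by apply: (card_finPcharP (n := 1)).
by case/andP=> _ /eqP.
Qed.

Lemma F3_eq0_or_sqr1 (z : F) : z = 0 \/ z ^+ 2 = 1.
Proof.
have /eqP : z * (z ^+ 2 - 1) = 0.
  by have := expf_card z; rewrite F3 mulrBr mulr1 -exprS => ->; rewrite subrr.
by rewrite mulf_eq0 subr_eq0 => /orP[]/eqP; [left | right].
Qed.

Lemma F3_two_neq0 : 2%:R != 0 :> F.
Proof.
have -> : 2%:R = - 1 :> F by apply: (lincomb 1 three_eq0); ring.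
by rewrite oppr_eq0 oner_neq0.
Qed.

(** As [-1] is not a square, [b] does not vanish, and the equation determines
    [c]. *)
Lemma F3_traceless (a b c : F) :
  a ^+ 2 + b * c = - 1 -> b ^+ 2 = 1 /\ c = - (1 + a ^+ 2) * b.
Proof.
move=> sq; have [b0 | b2] := F3_eq0_or_sqr1 b.
  have a2 : a ^+ 2 = - 1 by rewrite -sq b0 mul0r addr0.
  case/eqP: (oner_neq0 F); have [a0 | a2'] := F3_eq0_or_sqr1 a.
    by apply: (lincomb 1 a2); rewrite a0; ring.
  rewrite a2 in a2'; apply: (mulfI F3_two_neq0).
  by apply: (lincomb (- 1) a2'); ring.
split=> //; apply: (lincomb b sq).
have -> : b * (a ^+ 2 + b * c - - 1) = b * (1 + a ^+ 2) + b ^+ 2 * c by ring.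
by rewrite b2; ring.
Qed.

(** Two traceless matrices anticommute when the trace of their product
    vanishes.  Otherwise the upper left entries [a] and [a'] vanish together,
    or [a * a' = b * b'] with [b] and [b'] the upper right entries, and the two
    matrices are equal up to sign. *)
Lemma F3_commute_up_to_sign (A B : 'M[F]_2) :
  \det A = 1 -> \tr A = 0 -> \det B = 1 -> \tr B = 0 ->
  A * B = B * A \/ A * B = - (B * A).
Proof.
move=> detA trA detB trB.
have [a [b [c [/F3_traceless[b2 ->] ->]]]] := traceless_mx2 detA trA.
have [a' [b' [c' [/F3_traceless[b2' ->] ->]]]] := traceless_mx2 detB trB.
have comm : a * b' = a' * b -> a ^+ 2 = a' ^+ 2 ->
    mx2 a b (- (1 + a ^+ 2) * b) (- a) * mx2 a' b' (- (1 + a' ^+ 2) * b') (- a') =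
    mx2 a' b' (- (1 + a' ^+ 2) * b') (- a') * mx2 a b (- (1 + a ^+ 2) * b) (- a).
  move=> e sqe; rewrite !mulmx2 sqe; congr mx2; try ring.
    by apply: (lincomb 2%:R e); ring.
  by apply: (lincomb (2%:R * (1 + a' ^+ 2)) e); ring.
have anti : 2%:R * a * a' = (2%:R + a ^+ 2 + a' ^+ 2) * b * b' ->
    mx2 a b (- (1 + a ^+ 2) * b) (- a) * mx2 a' b' (- (1 + a' ^+ 2) * b') (- a') =
    - (mx2 a' b' (- (1 + a' ^+ 2) * b') (- a') * mx2 a b (- (1 + a ^+ 2) * b) (- a)).
  by move=> e; rewrite !mulmx2 oppmx2; congr mx2; try ring; apply: (lincomb 1 e); ring.
have [a0 | a2] := F3_eq0_or_sqr1 a; have [a0' | a2'] := F3_eq0_or_sqr1 a'.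
- by left; apply: comm; rewrite a0 a0' ?mul0r.
- by right; apply: anti;
  apply: (lincomb (- b * b') three_eq0); rewrite a0 a2'; ring.
- by right; apply: anti;
  apply: (lincomb (- b * b') three_eq0); rewrite a0' a2; ring.
have : (a * a') ^+ 2 == (b * b') ^+ 2 by rewrite !exprMn a2 a2' b2 b2'.
rewrite eqf_sqr => /orP[]/eqP e.
  left; apply: comm; rewrite ?a2 //; apply: (lincomb (a' * b') e).
  have -> : a' * b' * (a * a' - b * b') =
      a' ^+ 2 * a * b' - b' ^+ 2 * b * a' by ring.
  by rewrite a2' b2'; ring.
right; apply: anti; rewrite -mulrA e a2 a2'.
apply: (lincomb (- 2%:R * b * b') three_eq0); ring.
Qed.

End ThreeElements.

(** * The class of involutions *)

Section Involutions.

Variable F : finFieldType.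

Local Open Scope ring_scope.

Implicit Types A B D : 'M[F]_2.

Definition psl_involutions : {set coset_of 'Z(SL2 F)%g} :=
  [set x in PSL2 F | #[x]%g == 2].

Hypothesis odd_F : 2%:R != 0 :> F.

Lemma mem_psl_involutions A :
  \det A = 1 -> (psl A \in psl_involutions) = (\tr A == 0).
Proof. by move=> detA; rewrite inE psl_mem // order_psl. Qed.

Lemma psl_involutionsP x :
  reflect (exists A, [/\ \det A = 1, \tr A = 0 & x = psl A]) (x \in psl_involutions).
Proof.
apply: (iffP idP) => [xI | [A [detA trA ->]]]; last by rewrite mem_psl_involutions ?trA.
have [A detA defx] : exists2 A, \det A = 1 & x = psl A.
  by apply: psl_surj; move: xI; rewrite inE => /andP[].
by exists A; split=> //; apply/eqP; rewrite -mem_psl_involutions // -defx.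
Qed.

(** The rows of [P] are [v = (x, y)] and [v * A]; as [A * A = - 1], the map [A]
    sends them to the second row and to the opposite of the first one.  The
    determinant of [P] is the quadratic form
    [b x^2 - 2 a x y - c y^2], and [b] times it is [(b x - a y)^2 + y^2]. *)
Lemma traceless_conj A : \det A = 1 -> \tr A = 0 ->
  exists2 P, \det P = 1 & P * A = mx2 0 1 (- 1) 0 * P.
Proof.
move=> detA trA; have [a [b [c [sq ->]]]] := traceless_mx2 detA trA.
suff [x [y Q1]] : exists x y, b * x ^+ 2 - 2%:R * a * x * y - c * y ^+ 2 = 1.
  exists (mx2 x y (x * a + y * c) (x * b - y * a)).
    by rewrite det_mx2; apply: (lincomb 1 Q1); ring.
  rewrite !mulmx2; congr mx2; try ring.
    by apply: (lincomb x sq); ring.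
  by apply: (lincomb y sq); ring.
have [b0 | bn0] := eqVneq b 0.
  (* The form is then [- y (2 a x + c y)], and [y = 1] leaves a linear equation. *)
  have an0 : a != 0.
    apply: contra_eq_neq sq => ->; rewrite b0 mul0r expr0n addr0 eq_sym oppr_eq0.
    exact: oner_neq0.
  by exists (- (1 + c) / (2%:R * a)), 1; rewrite b0; field; rewrite an0.
have [X [y XY]] := sum_two_squares b; exists ((X + a * y) / b), y.
apply: (mulfI bn0); apply: (lincomb 1 XY).
apply: (lincomb (- y ^+ 2) sq); field; exact: bn0.
Qed.

Lemma psl_involutions_class : psl_involutions \in classes (PSL2_group F).
Proof.
have detW : \det (mx2 0 1 (- 1) 0 : 'M[F]_2) = 1 by rewrite det_mx2; ring.
have trW : \tr (mx2 0 1 (- 1) 0 : 'M[F]_2) = 0 by rewrite tr_mx2; ring.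
apply/imsetP; exists (psl (mx2 0 1 (- 1) 0)); first exact: psl_mem.
apply/setP=> x; apply/idP/imsetP => [/psl_involutionsP[A [detA trA ->]] | [y yG ->]].
  have [P detP PA] := traceless_conj detA trA.
  exists (psl P); first exact: psl_mem.
  by rewrite conjgE -pslM // -PA pslM // mulKg.
have : psl (mx2 0 1 (- 1) 0) \in psl_involutions by rewrite mem_psl_involutions ?trW.
by rewrite !inE orderJ => /andP[? ->]; rewrite andbT groupJ.
Qed.

Lemma involution_classE C : involution_class (PSL2_group F) C <-> C = psl_involutions.
Proof.
split=> [[/imsetP[t tG ->] ord2] | ->]; last first.
  by split=> [|x]; [apply: psl_involutions_class | rewrite inE => /andP[_ /eqP]].
have tI : t \in psl_involutions by rewrite inE ord2 ?class_refl ?andbT.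
have [w _ defI] := imsetP psl_involutions_class.
by rewrite defI; apply/class_eqP; rewrite -defI.
Qed.

(** A matrix of square [-1] is killed by ['X^2 + 1], whose roots [i] and [- i] in a
    splitting field are distinct because the characteristic is odd. *)
Lemma semisimple_involution x : x \in psl_involutions -> semisimple x.
Proof.
case/psl_involutionsP=> A [detA trA ->].
exists (gl_of A); first exact: gl_of_SL2.
split=> //; rewrite gl_ofK //.
have szp : size ('X^2 + 1 : {poly F}) = 3.
  by rewrite size_polyDl ?size_polyXn ?size_poly1.
have pn0 : ('X^2 + 1 : {poly F}) != 0 by rewrite -size_poly_eq0 szp.
have [L [rs eqp _]] := FinSplittingFieldFor pn0.
exists L.
have [i i2] : exists i : L, i ^+ 2 = - 1.
  case: rs eqp => [|i rs] eqp.
    by have := eqp_size eqp; rewrite big_nil size_map_poly szp size_poly1.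
  exists i; apply/eqP; rewrite -subr_eq0 opprK; have := eqp_root eqp i.
  rewrite big_cons rootM root_XsubC eqxx /= => /eqP.
  by rewrite rmorphD /= map_polyXn rmorph1 !hornerE => ->.
have i_neqN : i != - i.
  rewrite -subr_eq0 opprK -mulr2n -mulr_natl mulf_eq0 negb_or.
  rewrite -(rmorph_nat (in_alg L)) fmorph_eq0 odd_F /=.
  by apply: contra_eq_neq i2 => ->; rewrite expr0n /= eq_sym oppr_eq0 oner_neq0.
apply/diagonalizableP; exists [:: i; - i]; first by rewrite /= inE i_neqN.
apply: mxminpoly_min; rewrite !big_cons big_nil mulr1 rmorphM !rmorphB /=.
rewrite !horner_mx_X !horner_mx_C raddfN opprK /=.
have sqA : map_mx (in_alg L) A * map_mx (in_alg L) A = - 1.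
  rewrite -[LHS]/(_ *m _) -map_mxM [A *m A]mx2_sqr detA trA scale0r sub0r.
  by rewrite map_mxN map_mx1.
set M := map_mx _ _ in sqA *.
have cM : M * i%:M = i%:M * M by apply: scalar_mxC.
rewrite mulrDr !mulrBl sqA cM addrA subrK -[X in _ - X]/(i%:M *m i%:M).
by rewrite -scalar_mxM -expr2 i2 raddfN opprK addrC subrr.
Qed.

End Involutions.

(** * Subracks of the class of involutions *)

Section Racks.

Variables (F : finFieldType) (C : {set coset_of 'Z(SL2 F)%g}).
Hypothesis CG : C \in classes (PSL2_group F).

Local Open Scope ring_scope.

Implicit Types (A B D : 'M[F]_2) (P : 'M[F]_2 -> Prop).

Definition psl_image P (x : class_rack CG) : Prop :=
  exists2 A, P A & val x = psl A.

Hypothesis odd_F : 2%:R != 0 :> F.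
Hypothesis defC : C = psl_involutions F.

Lemma mem_class A : \det A = 1 -> \tr A = 0 -> psl A \in C.
Proof. by move=> detA trA; rewrite defC mem_psl_involutions ?trA. Qed.

Lemma class_rack_opE (x y : class_rack CG) A B D :
  \det A = 1 -> \det B = 1 -> \det D = 1 -> val x = psl A -> val y = psl B ->
  val (rack_op x y) = psl D <-> A * B = D * A \/ A * B = - (D * A).
Proof. by move=> dA dB dD ex ey; rewrite -psl_conj // -ex -ey. Qed.

(** The hypotheses make the image of [P] a proper non-abelian subrack: [A0] and
    [B0] do not commute even up to sign, and the involution of [A1] lies
    outside. *)
Lemma nonabelian_subrack P A0 B0 A1 :
  (forall A, P A -> \det A = 1 /\ \tr A = 0) ->
  (forall A B, P A -> P B -> exists2 D, P D & A * B = D * A) ->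
  P A0 -> P B0 -> A0 * B0 <> B0 * A0 -> A0 * B0 <> - (B0 * A0) ->
  \det A1 = 1 -> \tr A1 = 0 -> (forall A, P A -> A1 <> A /\ A1 <> - A) ->
  ~ rack_abelian (class_rack CG) /\ ~ rack_minimal_nonabelian (class_rack CG).
Proof.
move=> Pinv Pclosed PA PB nAB naAB detA1 trA1 A1nP.
have detP A : P A -> \det A = 1 by case/Pinv.
have trP A : P A -> \tr A = 0 by case/Pinv.
pose lift A dA tA : class_rack CG := exist _ (psl A) (@mem_class A dA tA).
pose x := lift A0 (detP _ PA) (trP _ PA); pose y := lift B0 (detP _ PB) (trP _ PB).
have Sx : psl_image P x by exists A0.
have Sy : psl_image P y by exists B0.
have nxy : rack_op x y <> y.
  move/(congr1 val) => eq_y.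
  by have [] := (class_rack_opE (x := x) (y := y) (detP _ PA) (detP _ PB)
                  (detP _ PB) erefl erefl).1 eq_y.
split=> [ab | [_ min]]; first by apply: nxy; apply: ab.
apply: nxy; apply: (min (psl_image P)) => //; split; last first.
  exists (lift A1 detA1 trA1) => -[A PAA /= /(psl_eq detA1 (detP _ PAA))].
  by have [? ?] := A1nP A PAA; case.
split=> [|x' y' [A PxA ex] [B PyB ey]]; first by exists x.
have [D PD eD] := Pclosed _ _ PxA PyB; exists D => //.
by apply/(class_rack_opE (detP _ PxA) (detP _ PyB) (detP _ PD) ex ey); left.
Qed.

(** Conjugation by the involution of parameter [b] is the reflection
    [c |-> 2 b - c] of [F], and [0 1; -1 0] is not upper triangular. *)
Lemma borel_subrack (i : F) : i ^+ 2 = - 1 ->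
  ~ rack_abelian (class_rack CG) /\ ~ rack_minimal_nonabelian (class_rack CG).
Proof.
move=> i2; have in0 : i != 0.
  by apply: contra_eq_neq i2 => ->; rewrite expr0n /= eq_sym oppr_eq0 oner_neq0.
pose P A := exists b, A = mx2 i b 0 (- i).
apply: (@nonabelian_subrack P (mx2 i 0 0 (- i)) (mx2 i 1 0 (- i)) (mx2 0 1 (- 1) 0)).
- move=> _ [b ->]; rewrite det_mx2 tr_mx2; split; last by rewrite subrr.
  by apply: (lincomb (- 1) i2); ring.
- move=> _ _ [b ->] [c ->]; exists (mx2 i (2%:R * b - c) 0 (- i)); first by eexists.
  by rewrite !mulmx2; congr mx2; ring.
- by exists 0.
- by exists 1.
- rewrite !mulmx2 => /eq_mx2[_ e _ _]; case/eqP: (in0); apply: (mulfI odd_F).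
  by apply: (lincomb 1 e); ring.
- rewrite !mulmx2 oppmx2 => /eq_mx2[e _ _ _]; case/eqP: (in0); apply: (mulfI odd_F).
  by apply: (mulfI in0); apply: (lincomb 1 e); ring.
- by rewrite det_mx2; ring.
- by rewrite tr_mx2; ring.
- move=> _ [b ->]; rewrite oppmx2.
  by split=> /eq_mx2[/esym/eqP]; rewrite ?oppr_eq0 (negPf in0).
Qed.

(** Conjugation by the involution of parameter [s] is the reflection
    [t |-> s ^+ 2 / t] of the multiplicative group of [F].  It fixes [t] or sends
    it to [- t], the same involution, exactly when [(s / t) ^+ 4 = 1].  The
    subrack is proper because [1 -2; 1 -1] has a nonzero diagonal. *)
Lemma monomial_subrack (r : F) : r != 0 -> r ^+ 4 != 1 ->
  ~ rack_abelian (class_rack CG) /\ ~ rack_minimal_nonabelian (class_rack CG).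
Proof.
move=> rn0 r4.
pose P A := exists2 t, t != 0 & A = mx2 0 t (- t^-1) 0.
apply: (@nonabelian_subrack P (mx2 0 1 (- 1^-1) 0) (mx2 0 r (- r^-1) 0)
                              (mx2 1 (- 2%:R) 1 (- 1))).
- move=> _ [t tn0 ->]; rewrite det_mx2 tr_mx2; split; last by ring.
  by field.
- move=> _ _ [s sn0 ->] [t tn0 ->]; exists (mx2 0 (s ^+ 2 / t) (- (s ^+ 2 / t)^-1) 0).
    by exists (s ^+ 2 / t); rewrite // mulf_neq0 ?expf_neq0 ?invr_eq0.
  by rewrite !mulmx2; congr mx2; field; rewrite ?sn0 ?tn0.
- by exists 1; rewrite ?oner_neq0.
- by exists r.
- rewrite !mulmx2 => /eq_mx2[e _ _ _]; case/eqP: r4.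
  have : r ^+ 2 = 1 by apply: (lincomb r e); field; rewrite oner_neq0.
  by move=> r2; apply: (lincomb (r ^+ 2 + 1) r2); ring.
- rewrite !mulmx2 oppmx2 => /eq_mx2[e _ _ _]; case/eqP: r4.
  have : r ^+ 2 = - 1 by apply: (lincomb (- r) e); field; rewrite oner_neq0.
  by move=> r2; apply: (lincomb (r ^+ 2 - 1) r2); ring.
- by rewrite det_mx2; ring.
- by rewrite tr_mx2; ring.
- move=> _ [t _ ->]; rewrite oppmx2 oppr0.
  by split=> /eq_mx2[/eqP]; rewrite oner_eq0.
Qed.

Lemma class_rack_nonabelian : (3 < #|F|)%N ->
  ~ rack_abelian (class_rack CG) /\ ~ rack_minimal_nonabelian (class_rack CG).
Proof.
move=> gt3; have [/existsP[i /eqP] | ] := boolP [exists i : F, i ^+ 2 == - 1].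
  exact: borel_subrack.
rewrite negb_exists => /forallP no_i.
have : ~~ ([set: F] \subset [set 0; 1; - 1]).
  apply: contraL gt3 => /subset_leq_card; rewrite cardsT -leqNgt => /leq_trans->//.
  by rewrite setUC cardsU1 cards2; case: (_ \notin _); case: (_ == _).
case/subsetPn=> r _; rewrite !inE !negb_or -andbA => /and3P[rn0 rn1 rnN1].
apply: (monomial_subrack rn0); rewrite (exprM r 2 2) sqrf_eq1 negb_or no_i andbT.
by rewrite sqrf_eq1 negb_or rn1.
Qed.

Lemma class_rack_abelian3 : #|F| = 3 -> rack_abelian (class_rack CG).
Proof.
move=> F3 x y _ _; apply: val_inj.
have /psl_involutionsP[//|A [detA trA ex]] : val x \in psl_involutions F.
  by rewrite -defC; apply: valP.
have /psl_involutionsP[//|B [detB trB ey]] : val y \in psl_involutions F.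
  by rewrite -defC; apply: valP.
rewrite [RHS]ey; apply/(class_rack_opE detA detB detB ex ey).
exact: F3_commute_up_to_sign.
Qed.

End Racks.

Theorem corollary5p16 (p k q : nat) (F : finFieldType) :
  prime p -> odd p -> (0 < k)%N -> q = (p ^ k)%N -> #|F| = q ->
  (exists! C : {set coset_of 'Z(SL2 F)%g}, involution_class (PSL2_group F) C) /\
  forall (C : {set coset_of 'Z(SL2 F)%g}) (CG : C \in classes (PSL2_group F)),
    involution_class (PSL2_group F) C ->
    (forall x, x \in C -> semisimple x) /\
    (q = 3 -> rack_abelian (class_rack CG)) /\
    ((3 < q)%N -> ~ rack_abelian (class_rack CG) /\
                  ~ rack_minimal_nonabelian (class_rack CG)).
Proof.
move=> p_pr p_odd k_gt0 def_q cardF.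
have odd_F : (2%:R != 0 :> F)%R.
  have pF : p \in [pchar F]%R by apply: (card_finPcharP (n := k)); rewrite ?cardF.
  apply: contraL p_odd => two0.
  have : 2 \in [pchar F]%R by rewrite inE /= two0.
  by rewrite (pcharf_eq pF) inE => /eqP <-.
split.
  exists (psl_involutions F); split=> [|C]; first exact/involution_classE.
  by move/involution_classE => ->.
move=> C CG /(involution_classE odd_F) defC; split; last split.
- by move=> x; rewrite defC; apply: semisimple_involution.
- by move=> q3; apply: class_rack_abelian3; rewrite // cardF.
- by move=> q3; apply: class_rack_nonabelian; rewrite // cardF.
Qed.
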